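(* Let $n>1$ and $k>1$, let $G=(V,E)$ be a $k$-representable graph and let $w$ be a $k$-representant of $G$, i.e. a $k$-uniform word over $V$ representing $G$. Then the Cartesian product $G\,\square\,K_n$, whose nodes are denoted $x_1,\dots,x_n$ for $x\in V$, is $(k+n-1)$-representable; more precisely, the concatenation $w'=f_n(w)\,f_{n-1}(w)\cdots f_1(w)$ is a $(k+n-1)$-uniform word representing $G\,\square\,K_n$, where $f_1,\dots,f_n$ are the occurrence-based functions defined, for $x\in V$ and $i\in\{1,\dots,k\}$, by $$f_1(x,i)=\begin{cases} x_1 & \text{if } i=1,\\ x_nx_{n-1}\cdots x_1 & \text{if } 1<i\le k,\end{cases}$$ and, for $j=2,\dots,n$, $$f_j(x,i)=\begin{cases} x_j & \text{if } i=1,\\ x_{j-1}\cdots x_1\,x_n\cdots x_j & \text{if } i=2,\\ \epsilon & \text{if } 2<i\le k,\end{cases}$$ with $\epsilon$ the empty word. (Here $x_a\cdots x_b$ with $a\ge b$ denotes the word $x_ax_{a-1}\cdots x_b$ with decreasing indices.)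
   Context: Graphs are finite, simple and undirected. For a word $w$ over an alphabet $A$, two distinct letters $x,y\in A$ alternate in $w$ if deleting all letters other than $x,y$ from $w$ leaves a word of the form $xyxy\cdots$ or $yxyx\cdots$ (of even or odd length). A word $w$ over the alphabet $V$ represents (is a representant of) a graph $G=(V,E)$ if for all distinct $x,y\in V$: $(x,y)\in E$ if and only if $x$ and $y$ alternate in $w$. A word over $V$ is $k$-uniform if every letter of $V$ occurs exactly $k$ times in it. A graph is $k$-representable if some $k$-uniform word over its node set represents it; such a word is called a $k$-representant of the graph. Occurrence-based functions: given a map $h:V\times\{1,\dots,k\}\to (V')^*$ (words over an alphabet $V'$) and a word $w$ over $V$ in which every letter occurs at most $k$ times, $h(w)$ denotes the word over $V'$ obtained from $w$ by replacing, for each letter $x$ and each $i$, the $i$th occurrence (from the left) of $x$ in $w$ by the word $h(x,i)$. $K_n$ is the complete graph on $n$ nodes. The Cartesian product $G\,\square\,H$ of $G=(V_G,E_G)$ and $H=(V_H,E_H)$ has node set $V_G\times V_H$, with $(x,z)$ and $(y,x')$ adjacent if and only if either $x=y$ and $(z,x')\in E_H$, or $z=x'$ and $(x,y)\in E_G$. The node $x_i$ of $G\,\square\,K_n$ is the pair $(x,i)$ with $i\in\{1,\dots,n\}$; thus $x_i,y_j$ are adjacent if and only if ($i=j$ and $(x,y)\in E$) or ($i\ne j$ and $x=y$). *)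

(* Defs.v *)
From HB Require Import structures.
From mathcomp Require Import all_boot.
Set Implicit Arguments.
Unset Strict Implicit.
Unset Printing Implicit Defensive.

Record sgraph := SGraph {
  vertex :> finType;
  edge : rel vertex;
  edge_sym : symmetric edge;
  edge_irrefl : irreflexive edge
}.
Arguments edge {s}.

(* alt_word x y m is the word xyxy... of length m. *)
Definition alt_word (T : Type) (x y : T) (m : nat) : seq T :=
  mkseq (fun i => if odd i then y else x) m.

Definition alternate (T : eqType) (w : seq T) (x y : T) : Prop :=
  let s := [seq z <- w | (z == x) || (z == y)] in
  exists m, s = alt_word x y m \/ s = alt_word y x m.

Definition represents (G : sgraph) (w : seq G) : Prop :=
  forall x y : G, x != y -> (edge x y <-> alternate w x y).

Definition uniform (T : finType) (k : nat) (w : seq T) : Prop :=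
  forall x : T, count_mem x w = k.

Definition representant (G : sgraph) (k : nat) (w : seq G) : Prop :=
  uniform k w /\ represents w.

Definition representable (G : sgraph) (k : nat) : Prop :=
  exists w : seq G, representant k w.

(* Occurrences are numbered from 1; p is the part of the word already read. *)
Fixpoint occ_map_rec (T : eqType) (T' : Type) (h : T -> nat -> seq T')
    (p w : seq T) : seq T' :=
  if w is x :: w' then
    h x (count_mem x p).+1 ++ occ_map_rec h (rcons p x) w'
  else [::].

Definition occ_map (T : eqType) (T' : Type) (h : T -> nat -> seq T')
    (w : seq T) : seq T' := occ_map_rec h [::] w.

Section Complete.
Variable n : nat.
Definition complete_edge : rel 'I_n := fun i j => i != j.
Fact complete_sym : symmetric complete_edge.
Proof. by move=> i j; rewrite /complete_edge eq_sym. Qed.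
Fact complete_irrefl : irreflexive complete_edge.
Proof. by move=> i; rewrite /complete_edge eqxx. Qed.
Definition complete : sgraph := SGraph complete_sym complete_irrefl.
End Complete.

Section CartesianProduct.
Variables G H : sgraph.
Definition cart_edge : rel (G * H)%type := fun u v =>
  ((u.1 == v.1) && edge u.2 v.2) || ((u.2 == v.2) && edge u.1 v.1).
Fact cart_sym : symmetric cart_edge.
Proof.
move=> u v; rewrite /cart_edge (eq_sym u.1) (eq_sym u.2).
by rewrite (edge_sym u.1) (edge_sym u.2).
Qed.
Fact cart_irrefl : irreflexive cart_edge.
Proof. by move=> u; rewrite /cart_edge !edge_irrefl !andbF. Qed.
Definition cart_prod : sgraph := SGraph cart_sym cart_irrefl.
End CartesianProduct.

(* The node x_j (1 <= j <= n) is the pair of x and the ordinal of value j - 1.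
   desc n x a b is the word x_a x_(a-1) ... x_b, with a and b numbered from 1;
   it is empty when a < b. *)
Definition desc (T : Type) (n : nat) (x : T) (a b : nat) : seq (T * 'I_n) :=
  [seq (x, i) | i : 'I_n <- rev (enum 'I_n) & b <= i.+1 <= a].

(* cart_occ j is f_(j+1), since j : 'I_n is numbered from 0; thus the index
   j - 1 in the usual 1-based definition of f_j is the value of j here. *)
Definition cart_occ (T : Type) (n : nat) (j : 'I_n) (x : T) (i : nat)
    : seq (T * 'I_n) :=
  if i == 1 then [:: (x, j)]
  else if j == 0 :> nat then desc n x n 1
  else if i == 2 then desc n x j 1 ++ desc n x n j.+1
  else [::].

(* f_n(w) f_(n-1)(w) ... f_1(w) *)
Definition cart_word (T : eqType) (n : nat) (w : seq T) : seq (T * 'I_n) :=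
  flatten [seq occ_map (cart_occ j) w | j <- rev (enum 'I_n)].

(* Main.v *)
Require Import Defs.
From mathcomp Require Import all_boot.
From mathcomp Require Import zify.

Set Implicit Arguments.
Unset Strict Implicit.
Unset Printing Implicit Defensive.

(** Alternation of two letters is a condition on prefix counts: x and y
    alternate in w, with x first, exactly when every prefix of w contains as
    many x as y, or one x more.  Call this: x leads y in w.  The word built
    from w is a concatenation of blocks f_j(w), for j decreasing from n - 1 to
    0 (indices start at 0 here), and in a prefix of f_j(w) the number of x_i is
    a function [copies] of the number of x in the corresponding prefix of w.
    So questions about the new word become arithmetic conditions on prefix
    counts of w.

    Over a whole block f_j(w), every letter gains the same amount, except that
    the letters of index j gain one more.  Hence, up to a common shift, x_i has
    been seen once or not at all before f_j(w), according to whether j < i or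
    not ([leads_cart_word]), and each block can be studied separately.

    - The letters x_i and y_i of one layer have equal counts before each block.
      Block i sees the first two occurrences of x and y, and the last block at
      least all those after the first; the two together force the step condition on all of w, and
      conversely ([leads_cart_layer]).
    - The letters x_i and y_i' with x != y and i < i' cannot alternate
      ([leads_cart_cross]).  Block i' contains y_i' twice but x_i once, so y_i'
      must lead, and its second occurrence has to come after x_i: the second y
      of w is preceded by the second x.  Block i requires the opposite order.
    - The copies of one letter are written in the cyclic order
      x_(n-1) ... x_0 x_(n-1) ... x_0, so any two of them alternate
      ([leads_cart_clique]). *)

(** * Alternation as a condition on prefix counts *)

Definition in_step (a b : nat) : bool := b <= a <= b.+1.

Section Leads.
Variable T : eqType.
Implicit Types (x y z : T) (s t : seq T).

(** The counters a and b are the numbers of x and y read before s; keeping them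
    as arguments is what makes the condition split along concatenations. *)
Fixpoint leads x y a b s : bool :=
  in_step a b &&
  (if s is z :: s' then leads x y (a + (z == x)) (b + (z == y)) s' else true).

Lemma leads_in_step x y a b s : leads x y a b s -> in_step a b.
Proof. by case: s => [|z s] /= /andP[]. Qed.

Lemma leads_cat x y a b s t :
  leads x y a b (s ++ t) =
  leads x y a b s && leads x y (a + count_mem x s) (b + count_mem y s) t.
Proof.
elim: s a b => [|z s IH] a b /=.
  rewrite !addn0 andbT.
  case: (boolP (leads x y a b t)) => [/leads_in_step->//|_].
  by rewrite andbF.
by rewrite IH !addnA andbA.
Qed.

Lemma leads_shift x y c a b s : leads x y (c + a) (c + b) s = leads x y a b s.
Proof.
elim: s a b => [|z s IH] a b /=; last rewrite -!addnA IH.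
all: by rewrite /in_step -addnS !leq_add2l.
Qed.

Lemma leads_filter x y a b s :
  leads x y a b [seq z <- s | (z == x) || (z == y)] = leads x y a b s.
Proof.
elim: s a b => [//|z s IH] a b /=.
have [zx|zx] := boolP (z == x); have [zy|zy] := boolP (z == y);
  rewrite /= ?zx ?zy ?(negbTE zx) ?(negbTE zy) IH //.
rewrite !addn0; case: (boolP (leads x y a b s)) => [/leads_in_step->//|_].
by rewrite andbF.
Qed.

Lemma alt_wordS x y m : alt_word x y m.+1 = x :: alt_word y x m.
Proof.
rewrite /alt_word /mkseq /= -[1]addn0 iotaDl -map_comp; congr cons.
by apply: eq_map => i /=; case: (odd i).
Qed.

(** The two cases are the two states of the reader of an alternating word:
    with level counters it expects x, with x one ahead it expects y.  They
    have to be proved together since each letter swaps them. *)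
Lemma leads_alt_word x y a t : x != y ->
  all (fun z => (z == x) || (z == y)) t ->
  (leads x y a a t <-> t = alt_word x y (size t)) /\
  (leads x y a.+1 a t <-> t = alt_word y x (size t)).
Proof.
move=> xy; elim: t a => [|z t IH] a /=.
  by move=> _; rewrite /in_step !leqnn !leqnSn.
case/andP => zxy /IH {}IH; rewrite !alt_wordS.
have nlead c d s : ~~ in_step c d -> leads x y c d s = false.
  by move=> ncd; apply/negP => /leads_in_step; apply/negP.
have aa : in_step a a by rewrite /in_step leqnn leqnSn.
have a1a : in_step a.+1 a by rewrite /in_step leqnn leqnSn.
rewrite aa a1a /=.
case/orP: zxy => /eqP->;
  rewrite ?eqxx ?(negbTE xy) 1?eq_sym ?(negbTE xy) !addn0 !addn1.
- have [_ h] := IH a; split; first by rewrite h; split=> [{1}->|[]].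
  by rewrite nlead /in_step; [split=> // -[/eqP]; rewrite (negbTE xy) | lia].
- have [h _] := IH a.+1; split; last by rewrite h; split=> [{1}->|[]].
  rewrite nlead /in_step; last lia.
  by split=> // -[/eqP]; rewrite eq_sym (negbTE xy).
Qed.

Lemma alternate_leads x y s : x != y ->
  alternate s x y <-> leads x y 0 0 s \/ leads y x 0 0 s.
Proof.
move=> xy; have yx : y != x by rewrite eq_sym.
have size_alt u v m : size (alt_word u v m) = m by rewrite size_mkseq.
set t := [seq z <- s | (z == x) || (z == y)].
have tE : [seq z <- s | (z == y) || (z == x)] = t.
  by apply: eq_filter => z; rewrite orbC.
have tall : all (fun z => (z == x) || (z == y)) t by apply: filter_all.
have tall' : all (fun z => (z == y) || (z == x)) t.
  by rewrite -tE; apply: filter_all.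
rewrite -[leads x y _ _ _]leads_filter -[leads y x _ _ _]leads_filter tE -/t.
rewrite (leads_alt_word 0 xy tall).1 (leads_alt_word 0 yx tall').1.
split=> [[m [] E]|[] E]; rewrite -/t in E *.
- by left; rewrite E size_alt.
- by right; rewrite E size_alt.
- by exists (size t); left.
- by exists (size t); right.
Qed.

End Leads.

(** * Occurrence-based functions *)

Lemma prefix_of_rcons (T : eqType) (q w : seq T) z :
  prefix q (rcons w z) = (q == rcons w z) || prefix q w.
Proof.
elim: w q => [|x w IH] [|y q] //=; rewrite eqseq_cons; last first.
  by rewrite IH andb_orr.
by case: q => [|y' q]; rewrite orbF ?andbF ?andbT.
Qed.

Section OccMap.
Variables (T T' : eqType) (h : T -> nat -> seq T').

Lemma occ_map_rcons w z :
  occ_map h (rcons w z) = occ_map h w ++ h z (count_mem z w).+1.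
Proof.
rewrite /occ_map -[w in count_mem _ w]cat0s; elim: w [::] => [|y w IH] p /=.
  by rewrite !cats0.
by rewrite IH catA cat_rcons.
Qed.

Lemma leads_sparse (u v : T') a b s :
  count_mem u s + count_mem v s <= 1 ->
  leads u v a b s =
    in_step a b && in_step (a + count_mem u s) (b + count_mem v s).
Proof.
elim: s a b => [|z s IH] a b /=; first by rewrite !addn0 andbT andbb.
move=> le1; rewrite IH ?addnA; last by lia.
case: (boolP (in_step a b)) => //= ab.
have [zx|zx] := boolP (z == u); have [zy|zy] := boolP (z == v).
- by rewrite zx zy in le1; lia.
- have -> : count_mem u s = 0 by rewrite zx in le1; lia.
  have -> : count_mem v s = 0 by rewrite zx in le1; lia.
  by rewrite !addn0 andbb.
- have -> : count_mem u s = 0 by rewrite zy in le1; lia.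
  have -> : count_mem v s = 0 by rewrite zy in le1; lia.
  by rewrite !addn0 andbb.
- by rewrite !addn0 ab.
Qed.

(** When each image h z c contains at most one of the two letters, nothing can
    go wrong strictly inside an image, so only the prefixes of the new word
    that are images of prefixes of w have to be tested. *)
Lemma leads_occ_map (u v : T') a b w :
  (forall z c, count_mem u (h z c) + count_mem v (h z c) <= 1) ->
  leads u v a b (occ_map h w) <->
  forall q, prefix q w ->
    in_step (a + count_mem u (occ_map h q)) (b + count_mem v (occ_map h q)).
Proof.
move=> sparse; elim/last_ind: w => [|w z IH].
  split=> [/= /andP[ab _] [|//] _|/(_ [::] isT) /=]; first by rewrite !addn0.
  by rewrite !addn0 andbT.
rewrite occ_map_rcons leads_cat (leads_sparse _ _ (sparse _ _)); split.
  move=> /and3P[/IH L _ E] q; rewrite prefix_of_rcons => /orP[/eqP->|/L//].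
  by rewrite occ_map_rcons !count_cat !addnA.
move=> L; apply/and3P; split.
- by apply/IH => q qw; apply: L; rewrite prefix_of_rcons qw orbT.
- by apply: L; apply: prefix_rcons.
- by have := L _ (prefix_refl _); rewrite occ_map_rcons !count_cat !addnA.
Qed.

End OccMap.

Lemma occ_map_letters (T : eqType) (w : seq T) :
  occ_map (fun z _ => [:: z]) w = w.
Proof.
by elim/last_ind: w => // w z IH; rewrite occ_map_rcons IH cats1.
Qed.

Lemma leads_prefix (T : eqType) (x y : T) (w : seq T) : x != y ->
  leads x y 0 0 w <->
  forall q, prefix q w -> in_step (count_mem x q) (count_mem y q).
Proof.
move=> xy; have := @leads_occ_map _ _ (fun z _ => [:: z]) x y 0 0 w.
rewrite occ_map_letters => -> => [|z _ /=].
  by split=> L q /L; rewrite occ_map_letters.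
by have [->|_] := eqVneq z x; [rewrite (negbTE xy) | ]; lia.
Qed.

(** * The blocks of the word for the product with a complete graph *)

Section CartWord.
Variables (T : eqType) (n : nat).
Implicit Types (x y z : T) (i j : 'I_n) (w q : seq T).

Lemma count_desc x i z a b :
  count_mem (x, i) (desc n z a b) = (z == x) && (b <= i.+1 <= a).
Proof.
rewrite /desc count_map count_filter.
have [<-|zx] := eqVneq z x.
  rewrite (eq_count (a2 := fun j => (j == i) && (b <= i.+1 <= a))).
    case: (b <= i.+1 <= a).
      rewrite (eq_count (a2 := pred1 i)) => [|j]; last by rewrite /= andbT.
      by rewrite count_uniq_mem ?rev_uniq ?enum_uniq // mem_rev mem_enum.
    by rewrite (eq_count (a2 := pred0)) ?count_pred0 // => j; rewrite /= andbF.
  by move=> j /=; rewrite xpair_eqE eqxx /=; case: eqVneq => [->|].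
rewrite (eq_count (a2 := pred0)) ?count_pred0 // => j /=.
by rewrite xpair_eqE (negbTE zx).
Qed.

Lemma count_cart_occ x i j z c :
  count_mem (x, i) (cart_occ j z c) =
  (z == x) * (if c == 1 then j == i :> nat else (j == 0 :> nat) || (c == 2)).
Proof.
rewrite /cart_occ; case: eqP => _.
  by rewrite /= xpair_eqE -val_eqE addn0; case: (z == x); case: eqP.
case: eqP => _; first by rewrite count_desc ltn_ord; case: (z == x).
case: eqP => _; last by rewrite muln0.
rewrite count_cat !count_desc ltn_ord; case: (z == x) => //=.
by lia.
Qed.

(** Here j is the 0-based index of the block and a the number of letters x
    already read in w: the first one yields x_j alone, and later ones yield all
    copies of x, for ever in the last block and only once in the others. *)
Definition copies (j i a : nat) : nat :=
  (j == i) * (0 < a) + (if j == 0 then a.-1 else 1 < a).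

Lemma count_block x i j q :
  count_mem (x, i) (occ_map (cart_occ j) q) = copies j i (count_mem x q).
Proof.
elim/last_ind: q => [|q z IH]; first by rewrite /copies /= muln0; case: eqP.
rewrite occ_map_rcons count_cat IH count_cart_occ -cats1 count_cat /= /copies.
by have [->|_] := eqVneq z x; case: (j == 0 :> nat);
  case: (count_mem x q) => [|[|a]] /=; lia.
Qed.

Lemma pairwise_rev_enum : pairwise (fun i j => j < i) (rev (enum 'I_n)).
Proof.
rewrite -sorted_pairwise; last by move=> i j l; lia.
rewrite rev_sorted -[sorted _ _]/(sorted (relpre val ltn) _) -sorted_map.
by rewrite val_enum_ord; apply: iota_ltn_sorted.
Qed.

Lemma count_rev_enum i j s1 s2 :
  rev (enum 'I_n) = s1 ++ j :: s2 -> count_mem i s1 = (j < i).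
Proof.
move=> E; have := pairwise_rev_enum; rewrite E pairwise_cat /=.
case/and3P => + _ /andP[+ _].
rewrite allrel_consr => /andP[/allP big _] /allP small.
have : uniq (s1 ++ j :: s2) by rewrite -E rev_uniq enum_uniq.
rewrite cat_uniq => /andP[us1 _]; rewrite count_uniq_mem //.
have : i \in rev (enum 'I_n) by rewrite mem_rev mem_enum.
rewrite E mem_cat inE; have [/big-> //|_ /=] := boolP (i \in s1).
by case/orP => [/eqP->|/small]; lia.
Qed.

(** The common part c of the gains shifts both counters and thus disappears:
    only the occurrences of i and i' among the earlier block indices matter. *)
Lemma leads_flatten (T' : eqType) (u v : T') i i' (B : 'I_n -> seq T')
    (c : 'I_n -> nat) a b s :
  (forall j, count_mem u (B j) = (j == i) + c j) ->
  (forall j, count_mem v (B j) = (j == i') + c j) ->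
  leads u v a b (flatten [seq B j | j <- s]) <->
  in_step a b /\ forall s1 j s2, s = s1 ++ j :: s2 ->
    leads u v (a + count_mem i s1) (b + count_mem i' s1) (B j).
Proof.
move=> cu cv; elim: s a b => [|l s IH] a b /=.
  by rewrite andbT; split=> [ab|[]//]; split=> // -[].
rewrite leads_cat cu cv.
have -> : a + ((l == i) + c l) = c l + (a + (l == i)) by lia.
have -> : b + ((l == i') + c l) = c l + (b + (l == i')) by lia.
rewrite leads_shift; split.
  case/andP => Ll /IH[_ L]; split; first exact: leads_in_step Ll.
  move=> [|l' s1] j s2 [<-] E; first by rewrite /= !addn0.
  by rewrite /= !addnA; apply: L E.
case=> ab L; apply/andP; split.
  by have := L [::] l s erefl; rewrite /= !addn0.
have L' s1 j s2 : s = s1 ++ j :: s2 ->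
    leads u v (a + (l == i) + count_mem i s1)
      (b + (l == i') + count_mem i' s1) (B j).
  by move=> E; have := L (l :: s1) j s2; rewrite /= E !addnA; apply.
apply/IH; split=> //.
(* The counters after block l are in step because they are tested at its end. *)
have := L [::] l s erefl.
rewrite /= !addn0 -[B l]cats0 leads_cat => /andP[_] /=.
rewrite andbT cu cv /in_step; lia.
Qed.

(** Blocks come in decreasing order, so the extra occurrence of index i has
    been read before block j exactly when j < i. *)
Lemma leads_cart_word k w x y i i' : 1 < k ->
  count_mem x w = k -> count_mem y w = k ->
  leads (x, i) (y, i') 0 0 (cart_word n w) <->
  forall j, leads (x, i) (y, i') (j < i) (j < i') (occ_map (cart_occ j) w).
Proof.
move=> k1 cx cy; rewrite /cart_word.
have blockE z l j : count_mem z w = k ->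
    count_mem (z, l) (occ_map (cart_occ j) w) =
    (j == l) + (if j == 0 :> nat then k.-1 else 1).
  move=> cz; rewrite count_block cz /copies k1 (ltnW k1) muln1.
  by rewrite -(inj_eq val_inj).
rewrite (leads_flatten 0 0 _ (fun j => blockE _ _ j cx)
                             (fun j => blockE _ _ j cy)).
split=> [[_ L] j|L].
  have [s1 [s2 E]] : exists s1 s2, rev (enum 'I_n) = s1 ++ j :: s2.
    have : j \in rev (enum 'I_n) by rewrite mem_rev mem_enum.
    by case/splitPr => s1 s2; exists s1, s2.
  by have := L _ _ _ E; rewrite !add0n !(count_rev_enum _ E).
by split=> // s1 j s2 E; rewrite !add0n !(count_rev_enum _ E).
Qed.

Lemma leads_block x y i i' a b j w : x != y ->
  leads (x, i) (y, i') a b (occ_map (cart_occ j) w) <->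
  forall q, prefix q w ->
    in_step (a + copies j i (count_mem x q)) (b + copies j i' (count_mem y q)).
Proof.
move=> xy; rewrite leads_occ_map; last first.
  move=> z c; rewrite !count_cart_occ.
  by have [->|_] := eqVneq z x; [rewrite (negbTE xy) | ]; lia.
by split=> L q /L; rewrite !count_block.
Qed.

(** If i = 0, block 0 records a and b exactly.  Otherwise block 0 confuses 0
    and 1 occurrences, block i confuses 2 and more, and the two together still
    determine whether a and b are in step. *)
Lemma in_step_copies i a b :
  (forall j, in_step ((j < i) + copies j i a) ((j < i) + copies j i b)) <->
  in_step a b.
Proof.
split=> [L|ab j]; last first.
  move: ab; rewrite /in_step /copies.
  by case: (j == i :> nat) (j == 0 :> nat) => [] []; lia.
have i0 : 0 < n by apply: leq_ltn_trans (ltn_ord i).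
have := L i; have := L (Ordinal i0).
by rewrite /in_step /copies /=; case: (i : nat) => [|m]; rewrite ?eqxx /=; lia.
Qed.

Lemma leads_cart_layer k w x y i : 1 < k -> x != y ->
  count_mem x w = k -> count_mem y w = k ->
  leads (x, i) (y, i) 0 0 (cart_word n w) <-> leads x y 0 0 w.
Proof.
move=> k1 xy cx cy; rewrite (leads_cart_word _ _ k1) // leads_prefix //.
split=> [L q qw|L j]; last first.
  by apply/leads_block => // q /L ab; apply: (in_step_copies i _ _).2.
apply/(in_step_copies i) => j.
by have /(leads_block _ _ _ _ _ _ xy) := L j; apply.
Qed.

(** Reading w letter by letter, one of two distinct letters reaches its second
    occurrence before the other. *)
Lemma not_simultaneous x y w : x != y -> 1 < count_mem x w ->
  ~ (forall q, prefix q w -> (1 < count_mem x q) = (1 < count_mem y q)).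
Proof.
move=> xy + same.
suff H q : prefix q w -> count_mem x q <= 1.
  by have := H w (prefix_refl _); lia.
elim/last_ind: q => // q z IH qzw.
have qw : prefix q w by apply: prefix_trans qzw; apply: prefix_rcons.
have := same _ qzw; have := same _ qw; have := IH qw.
rewrite -cats1 !count_cat /=.
by have [->|_] := eqVneq z x; [rewrite (negbTE xy) | ]; lia.
Qed.

(** If x_i led, it would be behind y_i' at the end of block i'.  If y_i' led,
    block i' would give (second y seen implies second x seen), and block i the
    converse, so both would be seen at the same time. *)
Lemma leads_cart_cross k w x y i i' : 1 < k -> x != y -> i < i' ->
  count_mem x w = k -> count_mem y w = k ->
  ~ leads (x, i) (y, i') 0 0 (cart_word n w) /\
  ~ leads (y, i') (x, i) 0 0 (cart_word n w).
Proof.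
move=> k1 xy ii' cx cy; have yx : y != x by rewrite eq_sym.
have i'0 : (i' == 0 :> nat) = false by case: (i' : nat) ii'.
have i'i : (i' == i :> nat) = false by lia.
rewrite !(leads_cart_word _ _ k1) //; split=> L.
  have /(leads_block _ _ _ _ _ _ xy) /(_ w (prefix_refl _)) := L i'.
  by rewrite /in_step /copies i'0 i'i eqxx cx cy; lia.
apply: (not_simultaneous (x := x) (y := y) (w := w)) => //; first by rewrite cx.
move=> q qw.
have /(leads_block _ _ _ _ _ _ yx) /(_ q qw) := L i'.
have /(leads_block _ _ _ _ _ _ yx) /(_ q qw) := L i.
by rewrite /in_step /copies i'0 i'i eqxx; case: eqP; lia.
Qed.

(** Two decreasing sequences with the same elements are equal, so the reversed
    enumeration of the ordinals, restricted to i and i', is i' followed by i. *)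
Lemma filter_desc x i i' a b : i < i' ->
  [seq u <- desc n x a b | (u == (x, i')) || (u == (x, i))] =
  [seq (x, l) | l : 'I_n <- [:: i'; i] & b <= l.+1 <= a].
Proof.
move=> ii'; rewrite /desc filter_map -filter_predI.
rewrite (eq_filter (a2 := predI (fun l : 'I_n => b <= l.+1 <= a)
                                (fun l => (l == i') || (l == i)))); last first.
  by move=> l; rewrite /= !xpair_eqE eqxx andbC.
rewrite filter_predI; congr map; congr filter.
apply: (@irr_sorted_eq _ (fun l m : 'I_n => m < l)).
- by move=> l m r; lia.
- by move=> l; rewrite ltnn.
- apply: sorted_filter; first by move=> l m r; lia.
  by rewrite sorted_pairwise ?pairwise_rev_enum // => l m r; lia.
- by rewrite /= ii'.
- by move=> l; rewrite mem_filter mem_rev mem_enum !inE andbT.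
Qed.

(** Here one letter of w may yield both x_i and x_i', so the images themselves
    have to be inspected.  An image that contains both has the order x_i' x_i,
    unless i < j <= i', when it has the order x_i x_i'; in block j, this is
    exactly the range where x_i' is one ahead after the first x. *)
Lemma leads_cart_clique k w x i i' : 1 < k -> i < i' -> count_mem x w = k ->
  leads (x, i') (x, i) 0 0 (cart_word n w).
Proof.
move=> k1 ii' cx; apply/(leads_cart_word _ _ k1) => // j {k k1 cx}.
elim/last_ind: w => [|w z IH].
  by rewrite /= /in_step andbT; lia.
rewrite occ_map_rcons leads_cat IH /= !count_block.
have [zx|zx] := eqVneq z x; last first.
  rewrite leads_sparse !count_cart_occ (negbTE zx) ?mul0n // !addn0 andbb.
  by rewrite /in_step /copies; case: (j == 0 :> nat); lia.
rewrite zx; case: (count_mem x w) => [|a] {w IH z zx}.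
  rewrite leads_sparse !count_cart_occ ?eqxx /in_step /copies /=.
    by case: (j == 0 :> nat); lia.
  by lia.
have ni : (i' == i) = false by rewrite -val_eqE /=; lia.
have ni' : (i == i') = false by rewrite eq_sym.
rewrite -leads_filter /cart_occ /copies; have [j0|j0] := eqVneq (j : nat) 0.
  rewrite filter_desc //= !ltn_ord /= !xpair_eqE !eqxx ni ni' /in_step j0 /=.
  by lia.
case: a => [|a] /=.
  rewrite filter_cat !filter_desc //= !ltn_ord !andbT !ltnS.
  (* The position of j decides which half of the image of the second x holds
     each of the two copies. *)
  have [ji|ij] := leqP j i; last have [ji'|i'j] := leqP j i'.
  - have -> : j <= i' by lia.
    have -> : i' < j = false by lia.
    by rewrite /= !xpair_eqE !eqxx ni ni' /in_step /=; lia.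
  - by rewrite /= !xpair_eqE !eqxx ni ni' /in_step /=; lia.
  - by rewrite /= !xpair_eqE !eqxx ni ni' /in_step /=; lia.
by rewrite /in_step; lia.
Qed.

Lemma count_cart_word k w x i : 1 < k -> count_mem x w = k ->
  count_mem (x, i) (cart_word n w) = k + n - 1.
Proof.
move=> k1 cx; rewrite /cart_word count_flatten -map_comp sumnE big_map.
have n0 : 0 < n by apply: leq_ltn_trans (ltn_ord i).
rewrite (perm_big (enum 'I_n)) ?perm_rev //= big_enum /=.
under eq_bigr => j _ do rewrite count_block cx /copies k1 (ltnW k1) muln1.
rewrite big_split /= (bigD1 i) //= eqxx big1 => [|j ji]; last first.
  by rewrite val_eqE (negbTE ji).
rewrite (bigD1 (Ordinal n0)) //= (eq_bigr (fun=> 1)) => [|j j0]; last first.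
  by case: eqP => // jE; rewrite -val_eqE /= jE in j0.
rewrite sum1_card cardC1 card_ord; lia.
Qed.

End CartWord.

Theorem theorem10 (n k : nat) (hn : 1 < n) (hk : 1 < k) (G : sgraph)
    (w : seq G) (hw : representant k w) :
  representable (cart_prod G (complete n)) (k + n - 1) /\
  @representant (cart_prod G (complete n)) (k + n - 1) (cart_word n w).
Proof.
suff R : @representant (cart_prod G (complete n)) (k + n - 1) (cart_word n w).
  by split=> //; exists (cart_word n w).
case: hw => uw rw; split=> [[x i]|[x i] [y i'] uv].
  exact: count_cart_word (uw x).
rewrite [edge _ _]/((x == y) && (i != i') || (i == i') && edge x y).
rewrite alternate_leads //.
have [xy|xy] := eqVneq x y.
  subst y; have ii' : i != i' by move: uv; rewrite xpair_eqE eqxx.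
  rewrite ii' /=; split=> // _.
  have [lt|lt|eq] := ltngtP i i'; last by rewrite -val_eqE /= eq eqxx in ii'.
  - by right; apply: leads_cart_clique (uw x).
  - by left; apply: leads_cart_clique (uw x).
have yx : y != x by rewrite eq_sym.
have [<-|ii'] /= := eqVneq i i'.
  by rewrite !(leads_cart_layer _ hk) // -alternate_leads //; apply: rw.
split=> //; have [lt|lt|eq] := ltngtP i i'.
- by case: (leads_cart_cross hk xy lt (uw x) (uw y)) => A B [].
- by case: (leads_cart_cross hk yx lt (uw y) (uw x)) => A B [].
- by rewrite -val_eqE /= eq eqxx in ii'.
Qed.
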